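(* Let $f$ be a real-valued univariate function with domain $[0,U)$, where $U\in\{w\in\mathbb{R}: w>0\}\cup\{+\infty\}$. Let $\delta>0$ be in the domain of $f$. Assume that $f(0)=0$ and that $f$ is twice differentiable at $\delta$. Assume further that $f$ is continuous on $[0,\delta]$ and that $f'''$ exists and is decreasing on $(0,\delta]$. Let $g$ be the $\delta$-smoothing of $f$. Then $g(w)<f(w)$ for all $w\in(0,\delta)$.
   Context: Given $f$ on $[0,U)$ with $f(0)=0$ and $f$ twice differentiable at $\delta\in(0,U)$, the $\delta$-smoothing of $f$ is the function $g$ on $[0,U)$ defined by $g(w)=g_1w+\frac12 g_2w^2+\frac16 g_3w^3$ for $0\le w\le\delta$ and $g(w)=f(w)$ for $\delta<w<U$, where $$g_1=\frac{3f(\delta)}{\delta}-2f'(\delta)+\frac{\delta f''(\delta)}{2},\quad g_2=-\frac{6f(\delta)}{\delta^2}+\frac{6f'(\delta)}{\delta}-2f''(\delta),\quad g_3=\frac{6f(\delta)}{\delta^3}-\frac{6f'(\delta)}{\delta^2}+\frac{3f''(\delta)}{\delta}.$$ Decreasing means strictly decreasing: $\phi(w_1)>\phi(w_2)$ for all $w_1<w_2$. *)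

(* Defs.v *)
From HB Require Import structures.
From mathcomp Require Import all_boot all_order all_algebra.
From mathcomp Require Import all_classical all_reals all_analysis.
Set Implicit Arguments.
Unset Strict Implicit.
Unset Printing Implicit Defensive.
Import Order.TTheory GRing.Theory Num.Theory.
Import numFieldNormedType.Exports.
Local Open Scope classical_set_scope.
Local Open Scope ring_scope.

(* Functions on [0, U) are represented by total functions R -> R, whose values
   outside [0, U) are arbitrary. *)

(* [derivable (derive1n k f) x 1] alone does not say that the lower derivatives
   exist around x, because [derive1n k f] is a total function with unspecified
   values where the derivative does not exist; hence the recursive neighborhood
   clause. *)
Fixpoint differentiable_times (R : realType) (n : nat) (f : R -> R) (x : R)
    : Prop :=
  match n with
  | 0%N => True
  | k.+1 => (\forall y \near x, differentiable_times k f y)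
            /\ derivable (derive1n k f) x 1
  end.

Definition smoothing1 (R : realType) (f : R -> R) (delta : R) : R :=
  3 * f delta / delta - 2 * derive1 f delta + delta * derive1n 2 f delta / 2.

Definition smoothing2 (R : realType) (f : R -> R) (delta : R) : R :=
  - (6 * f delta / delta ^+ 2) + 6 * derive1 f delta / delta
  - 2 * derive1n 2 f delta.

Definition smoothing3 (R : realType) (f : R -> R) (delta : R) : R :=
  6 * f delta / delta ^+ 3 - 6 * derive1 f delta / delta ^+ 2
  + 3 * derive1n 2 f delta / delta.

Definition smoothing (R : realType) (f : R -> R) (delta : R) (w : R) : R :=
  if w <= delta then
    smoothing1 f delta * w + 1 / 2 * smoothing2 f delta * w ^+ 2
    + 1 / 6 * smoothing3 f delta * w ^+ 3
  else f w.

(* Main.v *)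
Require Import Defs.
From HB Require Import structures.
From mathcomp Require Import all_boot all_order all_algebra.
From mathcomp Require Import all_classical all_reals all_analysis.
From mathcomp Require Import ring lra.
Import Order.TTheory GRing.Theory Num.Theory.
Import numFieldNormedType.Exports.
Local Open Scope classical_set_scope.
Local Open Scope ring_scope.

(** The cubic part p of the smoothing is a Hermite interpolant of f: it agrees
    with f at 0 and has the same value, first and second derivative as f at
    delta. The theorem is the sign of the interpolation error, and that error
    can be expressed by a difference of two values of f'''.

    Fix w in (0, delta) and let e(x) = x (x - delta)^3. Like the error f - p,
    it vanishes at 0 and to third order at delta. Choose the constant c for
    which f - p - c e also vanishes at w. This function now has zeros 0, w and
    a triple zero delta, so Rolle's theorem, applied to each derivative in turn
    and reusing the zero at delta, gives two points a < b in (0, delta) where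
    its third derivative vanishes ([two_zeros_third_derivative]). Since p''' is
    constant and e'''(x) = 24 x - 18 delta, subtracting the two equations
    leaves 24 c (b - a) = f'''(b) - f'''(a), that is ([smoothing_error])

      24 (b - a) (f(w) - p(w)) = w (w - delta)^3 (f'''(b) - f'''(a)).

    Both factors on the right, the node product w (w - delta)^3 and the
    increment of the decreasing function f''', are negative, so f(w) > p(w). *)

Lemma Rolle_derive (R : realType) (u v : R -> R) (a b : R) : a < b ->
  {within `[a, b], continuous u} ->
  (forall x, a < x < b -> is_derive x 1 u (v x)) ->
  u a = u b -> exists2 c, a < c < b & v c = 0.
Proof.
move=> ab uC du uab.
have [x|c cab [_ dc]] := @Rolle R u a b ab _ uC uab.
  by rewrite in_itv => /du[].
exists c; first by move: cab; rewrite in_itv.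
by have [] := du c _; [move: cab; rewrite in_itv | rewrite dc => _ <-].
Qed.

(** Rolle's theorem for a function with the zeros 0 < w < d, the last one
    triple: besides d, u1 has a zero in each of the two gaps, hence u2 has two
    zeros besides d, and these with d give two zeros of u3. Only continuity is
    asked at 0, because 0 is used as a zero of u alone. *)
Lemma two_zeros_third_derivative (R : realType) (u u1 u2 u3 : R -> R)
    (w d : R) :
  0 < w < d -> {within `[0, d], continuous u} ->
  (forall x, 0 < x <= d -> is_derive x 1 u (u1 x)) ->
  (forall x, 0 < x <= d -> is_derive x 1 u1 (u2 x)) ->
  (forall x, 0 < x <= d -> is_derive x 1 u2 (u3 x)) ->
  u 0 = 0 -> u w = 0 -> u d = 0 -> u1 d = 0 -> u2 d = 0 ->
  exists a b, [/\ 0 < a, a < b, b < d, u3 a = 0 & u3 b = 0].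
Proof.
move=> /andP[w0 wd] uC du du1 du2 u0 uw ud u1d u2d.
(* Away from 0, continuity follows from differentiability. *)
have rolle (g g' : R -> R) (a b : R) : (forall x, 0 < x <= d -> is_derive x 1 g (g' x)) ->
    0 < a -> a < b -> b <= d -> g a = 0 -> g b = 0 ->
    exists2 c, a < c < b & g' c = 0.
  move=> dg a0 ab bd ga gb; apply: (@Rolle_derive R g g' a b) => //.
  - apply: derivable_within_continuous => x; rewrite in_itv/= => /andP[ax xb].
    by have [] := dg x _; first lra.
  - by move=> x /andP[ax xb]; apply: dg; lra.
  - by rewrite ga gb.
have [a1 /andP[a10 a1w] u1a1] : exists2 c, 0 < c < w & u1 c = 0.
  apply: (@Rolle_derive R u u1 0 w) => //; last by rewrite u0 uw.
  - apply: continuous_subspaceW uC => x /=.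
    by rewrite !in_itv/= => /andP[x0 xw]; lra.
  - by move=> x /andP[x0 xw]; apply: du; lra.
have [b1 /andP[b1w b1d] u1b1] := rolle _ _ w d du w0 wd (lexx d) uw ud.
have [a2 /andP[a2a a2b] u2a2] : exists2 c, a1 < c < b1 & u2 c = 0.
  by apply: (rolle u1 u2) => //; lra.
have [b2 /andP[b2b b2d] u2b2] : exists2 c, b1 < c < d & u2 c = 0.
  by apply: (rolle u1 u2) => //; lra.
have [a /andP[a_gt a_lt] u3a] : exists2 c, a2 < c < b2 & u3 c = 0.
  by apply: (rolle u2 u3) => //; lra.
have [b /andP[b_gt b_lt] u3b] : exists2 c, b2 < c < d & u3 c = 0.
  by apply: (rolle u2 u3) => //; lra.
by exists a, b; split => //; lra.
Qed.

Lemma is_derive_derive1n (R : realType) (k : nat) (f : R -> R) (x : R) :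
  differentiable_times k.+1 f x ->
  is_derive x 1 (derive1n k f) (derive1n k.+1 f x).
Proof. by case=> _ df; rewrite derive1nS derive1E; exact: derivableP. Qed.

Lemma differentiable_timesW (R : realType) (k : nat) (f : R -> R) (x : R) :
  differentiable_times k.+1 f x -> differentiable_times k f x.
Proof. by case=> /nbhs_singleton. Qed.

(** A formal polynomial rather than a function, so that its derivatives are
    computed by the algebra of polynomials. *)
Definition smoothing_poly {R : realType} (f : R -> R) (d : R) : {poly R} :=
  smoothing1 f d *: 'X + (1 / 2 * smoothing2 f d) *: 'X^2
  + (1 / 6 * smoothing3 f d) *: 'X^3.

Lemma smoothingE (R : realType) (f : R -> R) (d w : R) : w <= d ->
  smoothing f d w = (smoothing_poly f d).[w].
Proof. by move=> wd; rewrite /smoothing wd /smoothing_poly !hornerE. Qed.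

(** The coefficients g1, g2, g3 of the smoothing are the solution of exactly
    these linear conditions; p(0) = 0 is agreement with f at 0 when f(0) = 0. *)
Lemma smoothing_poly_interpolates (R : realType) (f : R -> R) (d : R)
    (p := smoothing_poly f d) : 0 < d ->
  [/\ p.[0] = 0, p.[d] = f d, p^`().[d] = derive1n 1 f d &
      p^`()^`().[d] = derive1n 2 f d].
Proof.
move=> d0; have dn0 : d != 0 by rewrite gt_eqF.
rewrite /p /smoothing_poly /smoothing1 /smoothing2 /smoothing3 !poly.derivE.
by rewrite !hornerE /=; split; field.
Qed.

Lemma smoothing_poly_deriv3 (R : realType) (f : R -> R) (d x : R) :
  (smoothing_poly f d)^`()^`()^`().[x] = smoothing3 f d.
Proof. by rewrite /smoothing_poly !poly.derivE !hornerE /=; field. Qed.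

(** The node polynomial of the interpolation problem solved by the smoothing,
    with the node 0 simple and the node d triple. *)
Definition node_poly {R : realType} (d : R) : {poly R} :=
  'X * ('X - d%:P) ^+ 3.

Lemma node_poly_vanishes (R : realType) (d : R) (e := node_poly d) :
  [/\ e.[0] = 0, e.[d] = 0, e^`().[d] = 0 & e^`()^`().[d] = 0].
Proof. by rewrite /e /node_poly !poly.derivE !hornerE /=; split; ring. Qed.

Lemma node_poly_deriv3 (R : realType) (d x : R) :
  (node_poly d)^`()^`()^`().[x] = 24 * x - 18 * d.
Proof. by rewrite /node_poly !poly.derivE !hornerE /=; ring. Qed.

(** The remainder of Hermite interpolation, with the fourth derivative of f in
    the usual formula replaced by a difference quotient of f'''; in this form
    the monotonicity of f''' decides the sign. *)
Lemma smoothing_error (R : realType) (f : R -> R) (d w : R) :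
  0 < w < d -> f 0 = 0 -> {within `[0, d], continuous f} ->
  (forall x, 0 < x <= d -> differentiable_times 3 f x) ->
  exists a b, [/\ 0 < a, a < b, b < d &
    24 * (b - a) * (f w - smoothing f d w) =
    w * (w - d) ^+ 3 * (derive1n 3 f b - derive1n 3 f a)].
Proof.
move=> /andP[w0 wd] f0 fC df.
have [p0 pd p1d p2d] := @smoothing_poly_interpolates R f d (lt_trans w0 wd).
have [e0 ed e1d e2d] := node_poly_vanishes R d.
have p3 := smoothing_poly_deriv3 R f d; have e3 := node_poly_deriv3 R d.
have ew : (node_poly d).[w] = w * (w - d) ^+ 3 by rewrite /node_poly !hornerE.
have ewn0 : (node_poly d).[w] != 0.
  by rewrite ew mulf_neq0 ?expf_neq0 ?subr_eq0 ?(gt_eqF w0) ?(lt_eqF wd).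
rewrite smoothingE ?ltW// -ew.
set p := smoothing_poly f d in p0 pd p1d p2d p3 *.
set e := node_poly d in e0 ed e1d e2d e3 ewn0 *.
clearbody p e.
(* The multiple of the node polynomial that makes the corrected error vanish
   at w too. *)
pose c := (f w - p.[w]) / e.[w].
pose q := p + c *: e.
have [a [b [a0 ab bd za zb]]] : exists a b, [/\ 0 < a, a < b, b < d,
    (derive1n 3 f - horner q^`()^`()^`()) a = 0 &
    (derive1n 3 f - horner q^`()^`()^`()) b = 0].
  apply: (@two_zeros_third_derivative R (f - horner q)
    (derive1n 1 f - horner q^`()) (derive1n 2 f - horner q^`()^`()) _ w d).
  - by rewrite w0 wd.
  - move=> x; apply: cvgB; first exact: fC.
    by apply: continuous_subspaceT => y; exact: continuous_horner.
  - move=> x xd; apply: is_deriveB.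
    apply: (@is_derive_derive1n R 0).
    exact/differentiable_timesW/differentiable_timesW/df.
  - move=> x xd; apply: is_deriveB.
    exact/is_derive_derive1n/differentiable_timesW/df.
  - by move=> x xd; apply: is_deriveB; exact/is_derive_derive1n/df.
  - by rewrite /q !fctE hornerD hornerZ f0 p0 e0; ring.
  - by rewrite /q /c !fctE hornerD hornerZ; field.
  - by rewrite /q !fctE hornerD hornerZ pd ed; ring.
  - by rewrite /q !fctE !poly.derivE hornerD hornerZ p1d e1d; ring.
  - by rewrite /q !fctE !poly.derivE hornerD hornerZ p2d e2d; ring.
exists a, b; split => //.
have q3 x : q^`()^`()^`().[x] = smoothing3 f d + c * (24 * x - 18 * d).
  by rewrite -(p3 x) -(e3 x) /q !poly.derivE hornerD hornerZ.
have f3 x : (derive1n 3 f - horner q^`()^`()^`()) x = 0 ->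
    derive1n 3 f x = smoothing3 f d + c * (24 * x - 18 * d).
  by rewrite -q3 => fq; apply/eqP; rewrite -subr_eq0; apply/eqP.
by rewrite (f3 _ za) (f3 _ zb) /c; field.
Qed.

Theorem theorem3p1 (R : realType) (U : \bar R) (f : R -> R) (delta : R)
  (U_gt0 : (0 < U)%E)
  (delta_gt0 : 0 < delta) (delta_ltU : (delta%:E < U)%E)
  (f0 : f 0 = 0)
  (f_diff2 : differentiable_times 2 f delta)
  (f_cont : {within `[0, delta], continuous f})
  (f_diff3 : forall w : R, 0 < w <= delta -> differentiable_times 3 f w)
  (f_decr3 : forall w1 w2 : R, 0 < w1 <= delta -> 0 < w2 <= delta ->
     w1 < w2 -> derive1n 3 f w2 < derive1n 3 f w1) :
  forall w : R, 0 < w < delta -> smoothing f delta w < f w.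
Proof.
move=> w wd.
have [a [b [a0 ab bd err]]] := @smoothing_error R f delta w wd f0 f_cont f_diff3.
have f3ba : derive1n 3 f b - derive1n 3 f a < 0.
  rewrite subr_lt0; apply: f_decr3 => //.
  - by rewrite a0 ltW// (lt_trans ab bd).
  - by rewrite (lt_trans a0 ab) ltW.
have node_lt0 : w * (w - delta) ^+ 3 < 0.
  have /andP[w0 wltd] := wd.
  by rewrite pmulr_rlt0// exprn_odd_lt0// subr_lt0.
have ba : 0 < 24 * (b - a) by rewrite mulr_gt0 ?subr_gt0.
by rewrite -subr_gt0 -(pmulr_rgt0 _ ba) err nmulr_rgt0.
Qed.
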